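(* Let $\Omega\subset\mathbb{R}^d$, $d\in\{2,3\}$, be an open connected bounded domain with smooth boundary, and let $W$ be a given smooth real-valued function on $\partial\Omega$. Let $I_0>0$ be given (independent of $\epsilon$). For each $\epsilon>0$ let $\Phi^*_\epsilon$ be the unique solution of the (nonlocal) Poisson-Boltzmann equation $$-\epsilon\Delta\Phi^*_\epsilon=\rho^*_\epsilon\quad\text{in }\Omega,\qquad \rho^*_\epsilon=I_0\left(\frac{e^{-\Phi^*_\epsilon}}{\int_\Omega e^{-\Phi^*_\epsilon}\,dx}-\frac{e^{\Phi^*_\epsilon}}{\int_\Omega e^{\Phi^*_\epsilon}\,dx}\right),$$ with boundary condition $\Phi^*_\epsilon|_{\partial\Omega}=W$. Then for each compact $K\subset\Omega$, $$\lim_{\epsilon\to0}\ \sup_{x\in K}|\rho^*_\epsilon(x)|=0.$$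
   Context: The function $W$ does not depend on $\epsilon$. ''Solution'' means a smooth (classical) solution on $\overline\Omega$; for each $\epsilon>0$ a unique solution of this boundary value problem exists. *)

(* Defs.v *)
From HB Require Import structures.
From mathcomp Require Import all_boot all_order all_algebra.
From mathcomp Require Import all_classical all_reals all_analysis.

Set Implicit Arguments.
Unset Strict Implicit.
Unset Printing Implicit Defensive.

Import Order.TTheory GRing.Theory Num.Theory.
Import numFieldNormedType.Exports.

Local Open Scope classical_set_scope.
Local Open Scope ring_scope.

(* Points of R^n are row vectors; the norm and the balls of ['rV[R]_n] are the
   max-norm ones, which induce the usual topology. *)

Definition rV_display : measure_display.
Proof. exact: default_measure_display. Qed.

Section measurable_rV.
Context (R : realType) (n : nat).

Let coord (i : 'I_n) (x : 'rV[R]_n) : measurableTypeR R := x ord0 i.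

Let rV_set0 : g_sigma_preimage coord set0.
Proof. exact: sigma_algebra0. Qed.

Let rV_setC A : g_sigma_preimage coord A -> g_sigma_preimage coord (~` A).
Proof. exact: sigma_algebraC. Qed.

Let rV_bigcup (F : (set 'rV[R]_n)^nat) :
  (forall i, g_sigma_preimage coord (F i)) ->
  g_sigma_preimage coord (\bigcup_i (F i)).
Proof. exact: sigma_algebra_bigcup. Qed.

(* The sigma-algebra generated by the coordinates, as for [n.-tuple R]; it is
   the Borel sigma-algebra of R^n. *)
HB.instance Definition _ := @isMeasurable.Build rV_display 'rV[R]_n
  (g_sigma_preimage coord) rV_set0 rV_setC rV_bigcup.

End measurable_rV.

Lemma measurable_rV_coord (R : realType) n (i : 'I_n) :
  measurable_fun [set: 'rV[R]_n] (fun x : 'rV[R]_n => x ord0 i : measurableTypeR R).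
Proof.
move=> _ Y mY; rewrite setTI; apply: sub_sigma_algebra => /=.
rewrite -bigcup_seq/=; exists i => /=; first by rewrite mem_index_enum.
by exists Y => //; rewrite setTI.
Qed.

Lemma measurable_fun_rVP d (T : measurableType d) (R : realType) n
    (f : T -> 'rV[R]_n) :
  (forall i, measurable_fun [set: T] (fun x => f x ord0 i : measurableTypeR R)) ->
  measurable_fun [set: T] f.
Proof.
move=> mf.
suff : g_sigma_preimage (fun i x => f x ord0 i : measurableTypeR R)
    `<=` measurable.
  rewrite (g_sigma_preimage_comp (fun i (y : 'rV[R]_n) => y ord0 i : measurableTypeR R) f).
  by move=> prefS _ A mA; apply: prefS; exists A.
apply: smallest_sub; first exact: sigma_algebra_measurable.
move=> A; rewrite -bigcup_seq => -[i _ [B mB <-]].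
exact: mf.
Qed.

Section lebesgue_step.
Context (R : realType) (n : nat).
Variable m : {sigma_finite_measure set 'rV[R]_n -> \bar R}.

Definition cons_rV (p : measurableTypeR R * 'rV[R]_n) : 'rV[R]_n.+1 :=
  row_mx (p.1 : R)%:M p.2 : 'rV[R]_(1 + n).

Definition uncons_rV (x : 'rV[R]_n.+1) : measurableTypeR R * 'rV[R]_n :=
  (x ord0 ord0, \row_i x ord0 (lift ord0 i)).

Lemma cons_rV0 p : cons_rV p ord0 ord0 = p.1.
Proof.
transitivity (cons_rV p ord0 (lshift n (ord0 : 'I_1))).
  by congr (cons_rV p _ _); exact/val_inj.
by apply: etrans (row_mxEl _ _ _ _) _; rewrite mxE eqxx.
Qed.

Lemma cons_rVS p i : cons_rV p ord0 (lift ord0 i) = p.2 ord0 i.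
Proof.
transitivity (cons_rV p ord0 (rshift 1 i)).
  by congr (cons_rV p _ _); exact/val_inj.
exact: etrans (row_mxEr _ _ _ _) _.
Qed.

Lemma cons_rVK : cancel cons_rV uncons_rV.
Proof.
move=> [x v]; rewrite /uncons_rV cons_rV0; congr (_, _).
by apply/rowP => i; rewrite mxE cons_rVS.
Qed.

Lemma measurable_cons_rV : measurable_fun setT cons_rV.
Proof.
apply: measurable_fun_rVP => i; have [j ->|->] := unliftP ord0 i.
  under eq_fun do rewrite cons_rVS.
  apply: (measurableT_comp (measurable_rV_coord j)); exact: measurable_snd.
under eq_fun do rewrite cons_rV0.
exact: measurable_fst.
Qed.

Lemma measurable_uncons_rV : measurable_fun setT uncons_rV.
Proof.
apply: measurable_fun_pair; first exact: measurable_rV_coord.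
apply: measurable_fun_rVP => i.
under eq_fun do rewrite mxE.
exact: measurable_rV_coord.
Qed.

Definition lebesgue_cons : set 'rV[R]_n.+1 -> \bar R :=
  pushforward (@lebesgue_measure R \x m)%E cons_rV.

Let lebesgue_cons0 : lebesgue_cons set0 = 0%E.
Proof. by rewrite /lebesgue_cons /pushforward preimage_set0 measure0. Qed.

Let lebesgue_cons_ge0 A : (0 <= lebesgue_cons A)%E.
Proof. by rewrite /lebesgue_cons /pushforward measure_ge0. Qed.

Let lebesgue_cons_sigma_additive : semi_sigma_additive lebesgue_cons.
Proof.
exact: (@measure_semi_sigma_additive _ _ _
  (measure_function_pushforward__canonical__measure_function_Measure
    (@lebesgue_measure R \x m)%E measurable_cons_rV)).
Qed.

HB.instance Definition _ := isMeasure.Build _ _ _ lebesgue_cons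
  lebesgue_cons0 lebesgue_cons_ge0 lebesgue_cons_sigma_additive.

Let lebesgue_cons_sigma_finite : sigma_finite setT lebesgue_cons.
Proof.
have /sigma_finiteP[F [TF ndF Foo]] := sigma_finiteT (@lebesgue_measure R).
have /sigma_finiteP[G [TG ndG Goo]] := sigma_finiteT m.
exists (fun k => uncons_rV @^-1` (F k `*` G k)).
  rewrite -preimage_bigcup -[LHS](@preimage_setT _ _ uncons_rV); congr (_ @^-1` _).
  rewrite -setXTT TF TG predeqE => -[x y]; split.
    move=> [/= [a _ Fax] [b _ Gby]]; exists (maxn a b) => //; split => /=.
      by move: x Fax; exact/subsetPset/ndF/leq_maxl.
    by move: y Gby; exact/subsetPset/ndG/leq_maxr.
  by move=> [k _ []/= ? ?]; split; exists k.
move=> k; have [mF Fk] := Foo k; have [mG Gk] := Goo k; split.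
  rewrite -[X in measurable X]setTI.
  by apply: measurable_uncons_rV => //; exact: measurableX.
rewrite /lebesgue_cons /pushforward (_ : _ @^-1` _ = F k `*` G k).
  by rewrite product_measure1E// lte_mul_pinfty// ge0_fin_numE.
rewrite -comp_preimage (_ : uncons_rV \o cons_rV = id)//.
by apply/funext; exact: cons_rVK.
Qed.

HB.instance Definition _ := Measure_isSigmaFinite.Build _ _ _ lebesgue_cons
  lebesgue_cons_sigma_finite.

End lebesgue_step.

(* Lebesgue measure on R^n, as the n-fold product of [lebesgue_measure]. *)
Fixpoint lebesgue_rV (R : realType) (n : nat) :
    {sigma_finite_measure set 'rV[R]_n -> \bar R} :=
  match n with
  | 0 => [the {sigma_finite_measure set 'rV[R]_0 -> \bar R} of \d_(0 : 'rV[R]_0)]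
  | n'.+1 => [the {sigma_finite_measure set 'rV[R]_n'.+1 -> \bar R} of
               lebesgue_cons (lebesgue_rV R n')]
  end.

Lemma lebesgue_rV_box (R : realType) n (A : 'I_n -> set (measurableTypeR R)) :
  (forall i, measurable (A i)) ->
  lebesgue_rV R n [set x : 'rV[R]_n | forall i, A i (x ord0 i)] =
  (\prod_(i < n) lebesgue_measure (A i))%E.
Proof.
elim: n A => [|n IH] A mA.
  by rewrite big_ord0 /= diracE mem_set// => -[].
rewrite big_ord_recl -IH//= /lebesgue_cons /pushforward.
rewrite -product_measure1E//; last first.
  rewrite (_ : [set _ | _] = \big[setI/setT]_(i < n)
     ((fun x : 'rV[R]_n => x ord0 i : measurableTypeR R) @^-1` A (lift ord0 i))).
    apply: bigsetI_measurable => i _.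
    by rewrite -[X in measurable X]setTI; exact: measurable_rV_coord.
  rewrite -bigcap_seq; apply/seteqP; split => x /= H i => [_|]; first exact: H.
  by apply: H; rewrite /= mem_index_enum.
congr (_ _); apply/seteqP; split => -[x v] /=.
  move=> H; split => [|i]; first by have := H ord0; rewrite cons_rV0.
  by have := H (lift ord0 i); rewrite cons_rVS.
move=> [Ax Av] i; have [j ->|->] := unliftP ord0 i; last by rewrite cons_rV0.
by rewrite cons_rVS.
Qed.

Section pde.
Context (R : realType) (d : nat).
Implicit Types (f g Phi W : 'rV[R]_d -> R) (Omega A U : set 'rV[R]_d).

Definition partial (i : 'I_d) f : 'rV[R]_d -> R := 'D_(delta_mx ord0 i) f.

Definition iter_partial (s : seq 'I_d) f : 'rV[R]_d -> R := foldr partial f s.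

Definition laplacian f (x : 'rV[R]_d) : R := \sum_(i < d) partial i (partial i f) x.

(* C^oo on an open set [U]: all iterated partial derivatives exist and are
   continuous at every point of [U]. *)
Definition smooth_open U f : Prop :=
  forall (s : seq 'I_d) (x : 'rV[R]_d), U x ->
    {for x, continuous (iter_partial s f)} /\
    (forall i, derivable (iter_partial s f) x (delta_mx ord0 i)).

(* Smoothness on an arbitrary set [A]: locally the restriction of a C^oo
   function defined on an open set of R^d; only the values of [f] on [A]
   matter. *)
Definition smooth_on A f : Prop :=
  forall x, A x -> exists U, exists g,
    [/\ open U, U x, smooth_open U g & forall y, A y -> U y -> f y = g y].

Definition boundary A : set 'rV[R]_d := closure A `\` interior A.

End pde.

(* Near every boundary point, after relabelling and reorienting the axes, the
   domain is the region lying strictly above the graph of a C^oo function of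
   the remaining d - 1 coordinates ([col' i x] is [x] without its [i]-th
   coordinate). *)
Definition smooth_boundary (R : realType) (d : nat) (Omega : set 'rV[R]_d) : Prop :=
  forall p, boundary Omega p ->
  exists r : R, exists i : 'I_d, exists reversed : bool,
  exists gamma : 'rV[R]_d.-1 -> R,
  [/\ 0 < r, smooth_open setT gamma &
      Omega `&` ball p r =
      [set x | gamma (col' i x) < (-1) ^+ reversed * x ord0 i] `&` ball p r].

Section poisson_boltzmann.
Context (R : realType) (d : nat).
Implicit Types (Omega : set 'rV[R]_d) (W Phi : 'rV[R]_d -> R).

Definition charge_density (I0 : R) Omega Phi (x : 'rV[R]_d) : R :=
  I0 * (expR (- Phi x) / (\int[lebesgue_rV R d]_(y in Omega) expR (- Phi y))
      - expR (Phi x) / (\int[lebesgue_rV R d]_(y in Omega) expR (Phi y))).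

Definition PB_solution (eps I0 : R) Omega W Phi : Prop :=
  [/\ smooth_on (closure Omega) Phi,
      forall x, Omega x ->
        - eps * laplacian Phi x = charge_density I0 Omega Phi x &
      forall x, boundary Omega x -> Phi x = W x].

End poisson_boltzmann.

(* Main.v *)
Require Import Defs.
From mathcomp Require Import all_boot all_order all_algebra.
From mathcomp Require Import all_classical all_reals all_analysis.
From mathcomp Require Import measurable_realfun ring lra.
Import Order.TTheory GRing.Theory Num.Theory.
Import numFieldNormedType.Exports.
Local Open Scope classical_set_scope.
Local Open Scope ring_scope.

Set Implicit Arguments.
Unset Strict Implicit.
Unset Printing Implicit Defensive.

(** The quantity [a e^-Phi - b e^Phi], with [a] and [b] the two normalised
    weights, is minus a strictly increasing function [g] of the value of [Phi],
    so the equation reads [eps * laplacian Phi = g (Phi)] and maximum principles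
    apply. Three observations give the result, with the explicit rate [O(eps)]
    on compact sets.

    First, [|Phi| <= M] uniformly in [eps], where [M] bounds the boundary data
    ([monotone_max_le]). At an interior maximum [laplacian Phi <= 0], hence
    [g (Phi) <= 0] there; so the bound holds as soon as [0 <= g M]. The nonlocal
    weights hide in [g], and neutrality is what controls them: the density has
    integral zero, so it vanishes identically if it has a constant sign
    ([charge_density_ge0_eq0]). If [g M] were negative, the maximum principle
    would make [g (Phi)] nonpositive, hence zero, on the domain, so [Phi] would
    be a constant larger than [M], against the boundary condition. Applying this
    to [- Phi] gives [g (- M) <= 0] and the lower bound.

    Second, let the ball of radius [r] about [c] lie in the domain, and maximise
    [Phi] minus the paraboloid of height [2 M] at distance [r] from [c]. A
    maximum point at distance at least [r] forces [Phi c <= - M], hence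
    [g (Phi c) <= 0]. At a nearer one the Laplacian of [Phi] is at most that of
    the paraboloid, which bounds [g (Phi c)] by [eps] times a constant depending
    only on [M], [r] and the dimension ([interior_estimate]). Using [- Phi] too,
    the density at [c] is [O(eps)].

    Third, a compact subset of the domain admits one radius [r] for all its
    points ([uniform_ball_radius]). *)

(** * The second-order condition at a maximum *)

Lemma is_derive_parabola (R : realType) (b k c : R) :
  is_derive c 1 (fun t : R => b * t + k * t ^+ 2) (b + 2 * k * c).
Proof.
have h1 : is_derive c 1 (fun t : R => b * t) b.
  by have := is_deriveZ b (is_derive_id c (1 : R)); rewrite /= [_ *: _]mulr1.
have h2 : is_derive c 1 (fun t : R => k * t ^+ 2) (2 * k * c).
  have did := is_derive_id c (1 : R).
  have [h3 h4] := is_deriveZ k (is_deriveM did did).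
  apply: DeriveDef; first exact: h3.
  by apply: (etrans h4); rewrite -[LHS]/(k * (c * 1 + c * 1)); ring.
exact: is_deriveD h1 h2.
Qed.

(** Subtracting the parabola reduces to a maximum at the origin; there the
    first derivative vanishes, and a positive second derivative would make the
    difference increase to the right of the origin. *)
Lemma second_order_bound (R : realType) (h h' : R -> R) (b k L : R) :
  (\forall t \near (0 : R), is_derive (t : R) 1 h (h' t)) ->
  is_derive (0 : R) 1 h' L ->
  (\forall t \near 0, h t <= h 0 + (b * t + k * t ^+ 2)) ->
  L <= 2 * k.
Proof.
move=> dh dh' hle; rewrite leNgt; apply/negP => kL.
pose p t := h t - (b * t + k * t ^+ 2).
pose p' t := h' t - (b + 2 * k * t).
have dp : \forall t \near (0 : R), is_derive (t : R) 1 p (p' t).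
  by apply: filterS dh => t dt; apply: is_deriveB => //; exact: is_derive_parabola.
have [s1 /= s10 dp1] : nbhs_ball (0 : R) [set t : R | is_derive t 1 p (p' t)].
  by apply/nbhs_ballP.
have [s2 /= s20 hle2] := (iffLR (nbhs_ballP _ _) hle).
pose s := Num.min s1 s2.
have s0 : 0 < s by rewrite lt_min s10.
have bs t : t \in `]-s, s[ -> `|t| < s by rewrite in_itv/= ltr_norml.
have dps t : t \in `]-s, s[ -> is_derive (t : R) 1 p (p' t).
  move=> /bs; rewrite lt_min => /andP[h1 _].
  by apply: dp1; rewrite /ball/= sub0r normrN.
have ps t : t \in `]-s, s[ -> p t <= p 0.
  move=> /bs; rewrite lt_min => /andP[_ h2].
  have := hle2 t; rewrite /ball/= sub0r normrN => /(_ h2).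
  by rewrite /p expr0n/= !mulr0 addr0 subr0 lerBlDr.
have zs : 0 \in `]-s, s[ by rewrite in_itv/= oppr_lt0 s0.
have p'0 : p' 0 = 0.
  have dmax : is_derive (0 : R) 1 p 0.
    apply: (@derive1_at_max _ p (-s) s) => //; first by lra.
    by move=> t /dps[].
  have [_ <-] := dps _ zs; by case: dmax.
have h'0 : h' 0 = b.
  by move: p'0; rewrite /p' mulr0 addr0 => /eqP; rewrite subr_eq0 => /eqP.
have [dvb dval] := dh'.
have : \forall t \near 0^', 2 * k < t^-1 *: (h' (t *: 1 + 0) - h' 0).
  by apply: cvgr_gt kL; rewrite -dval; exact: dvb.
move=> /(iffLR (nbhs_ballP _ _))[e /= e0 he].
pose u := Num.min s e / 2.
have m0 : 0 < Num.min s e by rewrite lt_min s0.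
have u0 : 0 < u by rewrite divr_gt0.
have um : u < Num.min s e by rewrite /u; lra.
have us : u < s by apply: lt_le_trans um _; rewrite ge_min lexx.
have ue : u < e by apply: lt_le_trans um _; rewrite ge_min lexx orbT.
have sub0u c : c \in `[0, u] -> c \in `]-s, s[.
  by rewrite !in_itv/= => /andP[c0 cu]; apply/andP; split; lra.
have dpu c : c \in `]0, u[ -> is_derive (c : R) 1 p (p' c).
  by rewrite in_itv/= => /andP[c0 cu]; apply/dps/sub0u; rewrite in_itv/= !ltW.
have cpu : {within `[0, u], continuous p}.
  by apply: derivable_within_continuous => c /sub0u/dps[].
have [c cu pc] := MVT u0 dpu cpu.
move: cu; rewrite in_itv/= => /andP[c0 cu].
have : 0 < p' c.
  have := he c; rewrite /ball/= sub0r normrN gtr0_norm// => /(_ (lt_trans cu ue)).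
  move=> /(_ (lt0r_neq0 c0)); rewrite addr0 h'0 /p'.
  rewrite -[c *: 1]/(c * 1) mulr1 -[_ *: _]/(_ * _) [X in _ < X]mulrC ltr_pdivlMr//.
  by lra.
have uI : u \in `]-s, s[ by rewrite in_itv/= us andbT (lt_trans _ u0)// oppr_lt0.
move=> h2; have := ps _ uI; rewrite leNgt -subr_gt0 pc subr0.
by rewrite mulr_gt0.
Qed.

Lemma is_derive_along_line (R : realType) d (f : 'rV[R]_d -> R)
    (y v : 'rV[R]_d) (t l : R) :
  is_derive (y + t *: v) v f l ->
  is_derive t 1 (fun s => f (y + s *: v)) l.
Proof.
have E : (fun h : R => h^-1 *: (((fun s => f (y + s *: v)) \o shift t) (h *: 1)
                                - f (y + t *: v))) =
         (fun h : R => h^-1 *: ((f \o shift (y + t *: v)) (h *: v)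
                                - f (y + t *: v))).
  apply/funext => h /=; congr (_ *: (f _ - _)).
  by rewrite -[h *: 1]/(h * 1) mulr1 scalerDl addrCA.
move=> [dvb dval]; apply: DeriveDef.
  by rewrite /derivable E.
by rewrite -dval /derive E.
Qed.

Lemma open_near_line (R : realType) d (U : set 'rV[R]_d) (y v : 'rV[R]_d) :
  open U -> U y -> \forall t \near (0 : R), U (y + t *: v).
Proof.
move=> oU Uy.
have cl : y + t *: v @[t --> (0 : R)] --> y + (0 : R) *: v.
  apply: (@cvgD _ _ _ (nbhs (0 : R)) _ (cst y) (fun t => t *: v)).
    exact: cvg_cst.
  by apply: cvgZr_tmp; exact: cvg_id.
rewrite scale0r addr0 in cl.
exact: cl _ (open_nbhs_nbhs (conj oU Uy)).
Qed.

(** * Functions twice derivable inside a domain *)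

Lemma smooth_on_closure_partial (R : realType) d (Omega : set 'rV[R]_d)
    (f : 'rV[R]_d -> R) (i : 'I_d) (x : 'rV[R]_d) :
  open Omega -> smooth_on (closure Omega) f -> Omega x ->
  derivable f x (delta_mx ord0 i) /\
  derivable (partial i f) x (delta_mx ord0 i).
Proof.
move=> oO sf Ox.
have [U [g [oU Ux sg fg]]] := sf _ (@subset_closure _ Omega x Ox).
have E z : Omega z -> U z -> \forall w \near z, f w = g w.
  move=> Oz Uz; near=> w; apply: fg.
    by apply: subset_closure; near: w; exact: open_nbhs_nbhs.
  by near: w; exact: open_nbhs_nbhs.
have [_ /(_ i) dg] := sg [::] x Ux.
have [_ /(_ i) d2g] := sg [:: i] x Ux.
split.
  by apply: near_eq_derivable dg; apply: filterS (E _ Ox Ux) => z ->.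
apply: near_eq_derivable d2g; near=> z; apply/esym/near_eq_derive.
apply: E; near: z; exact: open_nbhs_nbhs.
Unshelve. all: by end_near. Qed.

Lemma smooth_on_continuous (R : realType) d (A : set 'rV[R]_d)
    (f : 'rV[R]_d -> R) : smooth_on A f -> {within A, continuous f}.
Proof.
move=> sf; apply/subspace_continuousP => x Ax.
have [U [g [oU Ux sg fg]]] := sf _ Ax.
have [cg _] := sg [::] x Ux.
suff : f @ within A (nbhs x) --> g x by rewrite -(fg x Ax Ux).
apply: (@cvg_trans _ (g @ within A (nbhs x))).
  apply: near_eq_cvg; near=> z; apply/esym/fg; first by near: z; exact: withinT.
  near: z; apply: (@cvg_within _ (nbhs x)); exact: open_nbhs_nbhs.
by apply: cvg_trans cg; apply: cvg_app; exact: cvg_within.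
Unshelve. all: by end_near. Qed.

(** The part of smoothness up to the boundary that maximum principles use. Unlike
    the existence of local smooth extensions, it is visibly stable under
    negation, and the comparison arguments are applied to both a solution and
    its opposite. *)
Definition twice_derivable (R : realType) d (Omega : set 'rV[R]_d)
    (f : 'rV[R]_d -> R) : Prop :=
  {within closure Omega, continuous f} /\
  forall x i, Omega x -> derivable f x (delta_mx ord0 i) /\
                         derivable (partial i f) x (delta_mx ord0 i).

Lemma smooth_on_twice_derivable (R : realType) d (Omega : set 'rV[R]_d)
    (f : 'rV[R]_d -> R) :
  open Omega -> smooth_on (closure Omega) f -> twice_derivable Omega f.
Proof.
move=> oO sf; split; first exact: smooth_on_continuous.
by move=> x i; exact: smooth_on_closure_partial.
Qed.

Lemma partialN (R : realType) d (Omega : set 'rV[R]_d) (f : 'rV[R]_d -> R)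
    (x : 'rV[R]_d) (i : 'I_d) :
  twice_derivable Omega f -> Omega x ->
  partial i (fun y => - f y) x = - partial i f x.
Proof. by move=> [_ df] Ox; have [d1 _] := df x i Ox; exact: deriveN d1. Qed.

Lemma partialN_near (R : realType) d (Omega : set 'rV[R]_d) (f : 'rV[R]_d -> R)
    (x : 'rV[R]_d) (i : 'I_d) :
  open Omega -> twice_derivable Omega f -> Omega x ->
  \forall y \near x, - partial i f y = partial i (fun y => - f y) y.
Proof.
move=> oO cf Ox; near=> y; apply/esym/(partialN i cf).
by near: y; exact: open_nbhs_nbhs.
Unshelve. all: by end_near. Qed.

Lemma twice_derivableN (R : realType) d (Omega : set 'rV[R]_d) (f : 'rV[R]_d -> R) :
  open Omega -> twice_derivable Omega f -> twice_derivable Omega (fun y => - f y).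
Proof.
move=> oO cf; have [cont df] := cf; split.
  by move=> x; apply: cvgN; exact: cont.
move=> x i Ox; have [d1 d2] := df x i Ox; split.
  exact: derivableN d1.
exact: near_eq_derivable (partialN_near i oO cf Ox) (derivableN d2).
Qed.

Lemma laplacianN (R : realType) d (Omega : set 'rV[R]_d) (f : 'rV[R]_d -> R)
    (x : 'rV[R]_d) :
  open Omega -> twice_derivable Omega f -> Omega x ->
  laplacian (fun y => - f y) x = - laplacian f x.
Proof.
move=> oO cf Ox; rewrite /laplacian -sumrN; apply: eq_bigr => i _.
transitivity ('D_(delta_mx ord0 i) (fun y => - partial i f y) x).
  exact/esym/near_eq_derive/(partialN_near i oO cf Ox).
by have [_ d2] := cf.2 x i Ox; exact: deriveN d2.
Qed.

Lemma bounded_set_compact_closure (R : realType) n (Omega : set 'rV[R]_n) :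
  bounded_set Omega -> compact (closure Omega).
Proof.
move=> [M [_ HM]]; apply: bounded_closed_compact; last exact: closed_closure.
exists (`|M| + 2); split=> [|N NM x clx]; first exact: num_real.
have [z [Oz]] := clx _ (nbhsx_ballx x 1 ltr01).
rewrite -ball_normE/= => xz.
have zM : `|z| <= `|M| + 1 by apply: HM => //; rewrite ltr_pwDr// ler_norm.
rewrite -(subrK z x) (le_trans (ler_normD _ _))//; lra.
Qed.

Lemma twice_derivable_bounded (R : realType) d (Omega : set 'rV[R]_d)
    (f : 'rV[R]_d -> R) :
  bounded_set Omega -> twice_derivable Omega f ->
  exists C, forall x, closure Omega x -> `|f x| <= C.
Proof.
move=> bO [cf _].
have /compact_bounded[C [_ HC]] :=
  continuous_compact cf (bounded_set_compact_closure bO).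
exists (C + 1) => x clx; apply: (HC (C + 1)); first by rewrite ltrDl.
by exists x.
Qed.

Lemma twice_derivable_continuous (R : realType) d (Omega : set 'rV[R]_d)
    (f : 'rV[R]_d -> R) (x : 'rV[R]_d) :
  open Omega -> twice_derivable Omega f -> Omega x -> {for x, continuous f}.
Proof.
move=> oO [cf _] Ox.
have clx : (closure Omega)° x.
  apply: (interiorS (@subset_closure _ Omega)).
  exact: open_nbhs_nbhs.
have := (iffLR (subspace_continuousP _ _) cf) x (interior_subset clx).
by rewrite within_interior.
Qed.

(** * Maximum principles *)

Lemma ball_rVP (R : realType) n (c y : 'rV[R]_n) (e : R) : 0 < e ->
  ball c e y <-> forall i, ball (c ord0 i) e (y ord0 i).
Proof.
move=> e0; split=> [[_ h] i|h]; first exact: h.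
by split=> // i j; rewrite (ord1 i); exact: h.
Qed.

(** The hypothesis compares [f] with a parabola only along each coordinate line
    through [y], which is all that the pure second derivatives see. *)
Lemma laplacian_le (R : realType) d (Omega : set 'rV[R]_d)
    (f : 'rV[R]_d -> R) (y : 'rV[R]_d) (b : 'I_d -> R) (k : R) :
  open Omega -> twice_derivable Omega f -> Omega y ->
  (forall i, \forall t \near 0,
     f (y + t *: delta_mx ord0 i) <= f y + (b i * t + k * t ^+ 2)) ->
  laplacian f y <= (2 * k) *+ d.
Proof.
move=> oO [_ df] Oy hb; rewrite /laplacian -[d in leRHS]card_ord -sumr_const.
apply: ler_sum => i _; set e : 'rV[R]_d := delta_mx ord0 i.
have y0 : y + 0 *: e = y by rewrite scale0r addr0.
apply: (@second_order_bound _ (fun t => f (y + t *: e))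
  (fun t => partial i f (y + t *: e)) (b i)).
- apply: filterS (open_near_line e oO Oy) => t Ot.
  apply: (@is_derive_along_line _ _ f y e).
  by apply: DeriveDef => //; have [] := df _ i Ot.
- apply: (@is_derive_along_line _ _ (partial i f) y e).
  rewrite y0; apply: DeriveDef => //.
  by have [] := df _ i Oy.
- by rewrite y0; exact: hb.
Qed.

Definition sqdist (R : realType) d (c x : 'rV[R]_d) : R :=
  \sum_(i < d) (x ord0 i - c ord0 i) ^+ 2.

Lemma continuous_sqdist (R : realType) d (c : 'rV[R]_d) : continuous (sqdist c).
Proof.
apply: continuous_big => [|i _ x]; first exact: add_continuous.
have ci : (fun z : 'rV[R]_d => z ord0 i - c ord0 i) z @[z --> x]
    --> x ord0 i - c ord0 i.
  apply: (@cvgB _ _ _ (nbhs x) _ (fun z : 'rV[R]_d => z ord0 i)).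
    exact: coord_continuous.
  exact: cvg_cst.
exact: (cvgM ci ci).
Qed.

Lemma sqdist_shift (R : realType) d (c y : 'rV[R]_d) (i : 'I_d) (t : R) :
  sqdist c (y + t *: delta_mx ord0 i) =
  sqdist c y + (2 * (y ord0 i - c ord0 i) * t + t ^+ 2).
Proof.
rewrite /sqdist (bigD1 i)//= [in RHS](bigD1 i)//= !mxE !eqxx/=.
rewrite (eq_bigr (fun j => (y ord0 j - c ord0 j) ^+ 2)); first by ring.
by move=> j /negPf ji; rewrite !mxE eqxx ji mulr0 addr0.
Qed.

(** A maximum point of [f] minus a paraboloid either sits on the boundary or
    has second derivatives no larger than those of the paraboloid. With [k = 0]
    this is the weak maximum principle. *)
Lemma barrier_max (R : realType) d (Omega : set 'rV[R]_d) (f : 'rV[R]_d -> R)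
    (c : 'rV[R]_d) (k : R) :
  open Omega -> bounded_set Omega -> Omega !=set0 ->
  twice_derivable Omega f ->
  exists y, [/\ closure Omega y,
    forall x, closure Omega x -> f x - k * sqdist c x <= f y - k * sqdist c y &
    boundary Omega y \/ (Omega y /\ laplacian f y <= (2 * k) *+ d)].
Proof.
move=> oO bO [z Oz] sf.
have [cf _] := sf.
have cu : {within closure Omega, continuous (fun x => f x - k * sqdist c x)}.
  have ck : {within closure Omega, continuous (fun x => k * sqdist c x)}.
    apply: continuous_subspaceT => x.
    apply: (@cvgM _ _ (nbhs x) _ (cst k)); first exact: cvg_cst.
    exact: continuous_sqdist.
  by move=> x; apply: cvgB; [exact: cf|exact: ck].
have [|y] := compact_EVT_max _ (bounded_set_compact_closure bO) cu.
  by exists z; exact: subset_closure.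
rewrite inE => cly ymax'.
have ymax x : closure Omega x -> f x - k * sqdist c x <= f y - k * sqdist c y.
  by move=> clx; apply: ymax'; rewrite inE.
exists y; split=> //.
have [Oy|NOy] := pselect (Omega y); [right; split=> //|left].
  apply: (laplacian_le (b := fun i => k * (2 * (y ord0 i - c ord0 i))) oO sf Oy).
  move=> i; set e : 'rV[R]_d := delta_mx ord0 i.
  apply: filterS (open_near_line e oO Oy) => t Ot.
  have := ymax _ (@subset_closure _ Omega _ Ot).
  rewrite sqdist_shift; lra.
by split=> // /interior_subset.
Qed.

(** [neutral] is the abstract form of electric neutrality. To exclude [g M < 0],
    the maximum principle makes [g (f x)] nonpositive, hence zero, on [Omega],
    so that [f] takes there only the zero of [g], which exceeds [M]; at a
    boundary point this contradicts continuity, as [f] is at most [M] there. *)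
Lemma monotone_max_le (R : realType) d (Omega : set 'rV[R]_d)
    (f : 'rV[R]_d -> R) (g : R -> R) (eps M : R) :
  (0 < d)%N -> open Omega -> bounded_set Omega -> Omega !=set0 ->
  twice_derivable Omega f -> 0 < eps -> {mono g : s t / s <= t} ->
  (forall x, Omega x -> eps * laplacian f x = g (f x)) ->
  ((forall x, Omega x -> g (f x) <= 0) -> forall x, Omega x -> g (f x) = 0) ->
  (forall x, boundary Omega x -> f x <= M) ->
  0 <= g M /\ forall x, closure Omega x -> f x <= M.
Proof.
move=> d0 oO bO [z Oz] cf eps0 gm pde neutral fM.
have O0 : Omega !=set0 by exists z.
have gm' := leW_mono gm.
have [y [cly ymax' hy]] := barrier_max 0 0 oO bO O0 cf.
have ymax x : closure Omega x -> f x <= f y.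
  by move=> /ymax'; rewrite !mul0r !subr0.
have {hy} hy : boundary Omega y \/ (Omega y /\ g (f y) <= 0).
  case: hy => [by_|[Oy ly]]; [by left|right; split=> //].
  by rewrite -pde// pmulr_rle0//; move: ly; rewrite mulr0 mul0rn.
have gM : 0 <= g M.
  rewrite leNgt; apply/negP => gM0.
  have le0 x : Omega x -> g (f x) <= 0.
    move=> Ox; have fxy := ymax _ (@subset_closure _ Omega x Ox).
    case: hy => [/fM fyM|[_ gy]]; last by apply: le_trans gy; rewrite gm.
    by apply: ltW; apply: le_lt_trans gM0; rewrite gm (le_trans fxy).
  have {neutral} eq0 := neutral le0.
  (* The Laplacian of [f] is now zero, so adding the square distance makes it
     positive and excludes interior maxima: this produces a boundary point. *)
  have [p [clp _ hp]] := barrier_max 0 (-1) oO bO O0 cf.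
  case: hp => [/fM fpM|[Op]]; last first.
    have /eqP := pde _ Op; rewrite eq0// mulf_eq0 gt_eqF//= => /eqP ->.
    by rewrite leNgt mulrN1 mulNrn oppr_lt0 pmulrn_lgt0 ?d0 ?ltr0n.
  have fpz : f p < f z.
    by rewrite -gm' (eq0 _ Oz); apply: le_lt_trans gM0; rewrite gm.
  have fcvg := (iffLR (subspace_continuousP _ _) cf.1) p clp.
  have /clp[x [Ox /= fxz]] : within (closure Omega) (nbhs p) [set x | f x < f z].
    exact: cvgr_lt fcvg _ fpz.
  have := fxz (@subset_closure _ Omega x Ox).
  by rewrite -gm' !eq0// ltxx.
split=> // x /ymax fxy; apply: (le_trans fxy).
case: hy => [/fM//|[_ gy]]; by rewrite -gm (le_trans gy).
Qed.

(** The paraboloid [k * sqdist c] with [k = 2 M / r^2] reaches [2 M], the largest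
    possible oscillation of [f], at distance [r] from [c]; so the difference
    can be maximal at that distance or farther only if [f c <= - M]. *)
Lemma interior_estimate (R : realType) d (Omega : set 'rV[R]_d)
    (f : 'rV[R]_d -> R) (g : R -> R) (eps M r : R) (c : 'rV[R]_d) :
  open Omega -> bounded_set Omega ->
  twice_derivable Omega f -> 0 < eps -> {mono g : s t / s <= t} ->
  (forall x, Omega x -> eps * laplacian f x = g (f x)) ->
  0 <= M -> g (- M) <= 0 -> (forall x, closure Omega x -> `|f x| <= M) ->
  0 < r -> ball c r `<=` Omega ->
  g (f c) <= eps * ((4 * M / r ^+ 2) *+ d).
Proof.
move=> oO bO cf eps0 gm pde M0 gM fM r0 cr.
have Oc : Omega c by apply: cr; exact: ballxx.
have r20 : 0 < r ^+ 2 by rewrite exprn_gt0.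
pose k := 2 * M / r ^+ 2.
have k0 : 0 <= k by rewrite /k divr_ge0 ?(ltW r20)// mulr_ge0.
have -> : 4 * M / r ^+ 2 = 2 * k by rewrite /k; field; rewrite gt_eqF.
have [y [cly ymax hy]] : exists y, [/\ closure Omega y,
    forall x, closure Omega x -> f x - k * sqdist c x <= f y - k * sqdist c y &
    boundary Omega y \/ (Omega y /\ laplacian f y <= (2 * k) *+ d)].
  by apply: barrier_max => //; exists c.
have q0 x : 0 <= sqdist c x by apply: sumr_ge0 => i _; exact: sqr_ge0.
have qc : sqdist c c = 0.
  by rewrite /sqdist big1// => i _; rewrite subrr expr0n.
have := ymax _ (@subset_closure _ Omega c Oc); rewrite qc mulr0 subr0 => fcy.
have [ry|yr] := leP (r ^+ 2) (sqdist c y).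
  have kM : 2 * M <= k * sqdist c y.
    by rewrite /k mulrAC ler_pdivlMr// ler_wpM2l// mulr_ge0.
  have fcM : f c <= - M.
    by have := fM y cly; rewrite ler_norml => /andP[_ fyM]; lra.
  apply: (@le_trans _ _ 0); first by apply: le_trans gM; rewrite gm.
  by rewrite mulr_ge0 ?(ltW eps0)// mulrn_wge0// mulr_ge0.
have Oy : Omega y.
  (* Balls are those of the max norm, so they contain the Euclidean ones. *)
  apply: cr; apply/ball_rVP => // i; rewrite /ball/= distrC.
  rewrite -ltr_sqr ?nnegrE ?(ltW r0)// real_normK ?num_real//.
  apply: le_lt_trans yr; rewrite /sqdist (bigD1 i)//= lerDl.
  by apply: sumr_ge0 => j _; exact: sqr_ge0.
case: hy => [[_ []]|[_ ly]]; first exact: open_nbhs_nbhs.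
apply: (@le_trans _ _ (g (f y))).
  by rewrite gm (le_trans fcy)// gerBl mulr_ge0.
by rewrite -pde// ler_pM2l.
Qed.

Lemma uniform_ball_radius (R : realType) d (K Omega : set 'rV[R]_d) :
  compact K -> open Omega -> K `<=` Omega ->
  exists r : R, 0 < r /\ forall x, K x -> ball x r `<=` Omega.
Proof.
move=> /compact_near_coveringP cK oO KO.
have : \forall r \near (0 : R)^'+, K `<=` [set x | ball x r `<=` Omega].
  apply: (cK _ _ (fun r x => ball x r `<=` Omega)) => x Kx.
  have /nbhs_ballP[e /= e0 eO] : nbhs x Omega.
    by apply: open_nbhs_nbhs; split => //; exact: KO.
  have e20 : 0 < e / 2 by rewrite divr_gt0.
  exists (ball x (e / 2), [set r | r < e / 2]).
    by split; [exact: nbhsx_ballx|exact: nbhs_right_lt].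
  move=> [x' r] [/= xx' re] z x'z; apply: eO.
  by apply: ball_split xx' _; apply: le_ball x'z; exact: ltW.
move=> near_r.
have [r [r0 rK]] := filter_ex (filterI (nbhs_right_gt (0 : R)) near_r).
by exists r; split=> // x; exact: rK.
Qed.

(** * Lebesgue measure and continuous functions on R^n *)

Lemma measurable_box (R : realType) n (A : 'I_n -> set (measurableTypeR R)) :
  (forall i, measurable (A i)) ->
  measurable [set x : 'rV[R]_n | forall i, A i (x ord0 i)].
Proof.
move=> mA; rewrite (_ : [set _ | _] =
    \bigcap_i ((fun x : 'rV[R]_n => x ord0 i : measurableTypeR R) @^-1` A i)).
  apply: fin_bigcap_measurable => // i _.
  by rewrite -[X in measurable X]setTI; exact: measurable_rV_coord.
by apply/seteqP; split=> x /= h i; [move=> _; exact: h|exact: h].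
Qed.

Lemma ball_rV_box (R : realType) n (c : 'rV[R]_n) (e : R) : 0 < e ->
  ball c e = [set y | forall i, ball (c ord0 i) e (y ord0 i)].
Proof. move=> e0; apply/seteqP; split=> y /= h; exact/(ball_rVP _ _ e0). Qed.

Lemma measurable_ball_rV (R : realType) n (c : 'rV[R]_n) (e : R) : 0 < e ->
  measurable (ball c e).
Proof.
move=> e0; rewrite ball_rV_box//.
apply: (measurable_box (A := fun i => ball (c ord0 i) e)) => i.
exact: measurable_ball.
Qed.

Lemma lebesgue_rV_ball (R : realType) n (c : 'rV[R]_n) (e : R) : 0 < e ->
  lebesgue_rV R n (ball c e) = ((e *+ 2) ^+ n)%:E.
Proof.
move=> e0; rewrite ball_rV_box//.
rewrite (lebesgue_rV_box (A := fun i => ball (c ord0 i) e)); last first.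
  by move=> i; exact: measurable_ball.
under eq_bigr do rewrite lebesgue_measure_ball ?ltW//.
by rewrite prodEFin prodr_const card_ord.
Qed.

(** Rational balls form a countable base, so an open set is a countable union
    of boxes; this is what ties the topology to the coordinate
    sigma-algebra. *)
Lemma open_measurable_rV (R : realType) n (U : set 'rV[R]_n) :
  open U -> measurable U.
Proof.
move=> oU.
pose c (p : 'rV[rat]_n * nat) : 'rV[R]_n := map_mx ratr p.1.
pose B p := ball (c p) p.2.+1%:R^-1.
pose F p := if `[< B p `<=` U >] then B p else set0.
rewrite (_ : U = \bigcup_p F p).
  apply: countable_bigcupT_measurable; first exact: countableP.
  by move=> p; rewrite /F; case: asboolP => // _; exact: measurable_ball_rV.
apply/seteqP; split=> [x Ux|x [p _]]; last first.
  by rewrite /F; case: asboolP => // sBU Bx; exact: sBU.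
have /nbhs_ballP[e /= e0 sU] : nbhs x U by exact: open_nbhs_nbhs.
have e20 : 0 < e / 2 by rewrite divr_gt0.
have [k /= ke] := filter_ex (near_infty_natSinv_lt (PosNum e20)).
have k0 : (0 : R) < k.+1%:R^-1 by rewrite invr_gt0.
have hq (i : 'I_n) : exists q : rat, `|x ord0 i - ratr q| < k.+1%:R^-1.
  have : x ord0 i - k.+1%:R^-1 < x ord0 i + k.+1%:R^-1.
    by rewrite ltrD2l; apply: lt_trans k0; rewrite oppr_lt0.
  move=> /rat_in_itvoo[q]; rewrite in_itv/= => /andP[h1 h2].
  exists q; rewrite ltr_norml ltrBrDr addrC -ltrBrDr opprK h2/=.
  by rewrite ltrBlDl addrC -ltrBlDl.
have [q hq'] := choice hq.
exists (\row_i q i, k) => //; rewrite /F.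
have Bx : B (\row_i q i, k) x.
  by apply/ball_rVP => // i; rewrite /ball/= !mxE distrC; exact: hq'.
case: asboolP => // -[] y By; apply: sU.
apply: (@ball_splitr _ _ (c (\row_i q i, k))).
  by apply: le_ball Bx; exact: ltW.
by apply: le_ball By; exact: ltW.
Qed.

Lemma open_continuous_measurable_rV (R : realType) n (U : set 'rV[R]_n)
    (f : 'rV[R]_n -> R) :
  open U -> (forall x, U x -> {for x, continuous f}) -> measurable_fun U f.
Proof.
move=> oU cf mU; apply: (measurability _ (RGenOInfty.measurableE R)) => //.
move=> _ [_ [a ->] <-]; apply: open_measurable_rV.
rewrite openE => x [Ux /=]; rewrite in_itv/= andbT => afx.
have Unear : \forall y \near x, U y by exact: open_nbhs_nbhs.
have fnear : \forall y \near x, a < f y by exact: cvgr_gt (cf x Ux) _ afx.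
rewrite /interior/=; near=> y; split; first by near: y.
by rewrite /= in_itv/= andbT; near: y.
Unshelve. all: by end_near. Qed.

Lemma bounded_set_finite_measure (R : realType) n (Omega : set 'rV[R]_n) :
  open Omega -> bounded_set Omega -> (lebesgue_rV R n Omega < +oo)%E.
Proof.
move=> oO [M [_ HM]]; pose N := `|M| + 1.
have N0 : 0 < N + 1 by rewrite addr_gt0// ltr_wpDl.
apply: (@le_lt_trans _ _ (lebesgue_rV R n (ball 0 (N + 1)))).
  apply: le_measure; rewrite ?inE; first exact: open_measurable_rV.
    exact: measurable_ball_rV.
  move=> x Ox; rewrite -ball_normE/= sub0r normrN (@le_lt_trans _ _ N)// ?ltrDl//.
  by apply: HM => //; rewrite /N ltr_pwDr// ler_norm.
by rewrite lebesgue_rV_ball// ltry.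
Qed.

Lemma bounded_continuous_integrable (R : realType) n (Omega : set 'rV[R]_n)
    (f : 'rV[R]_n -> R) (C : R) :
  open Omega -> bounded_set Omega ->
  (forall x, Omega x -> {for x, continuous f}) ->
  (forall x, Omega x -> `|f x| <= C) ->
  (lebesgue_rV R n).-integrable Omega (EFin \o f).
Proof.
move=> oO bO cf fC; apply: measurable_bounded_integrable.
- exact: open_measurable_rV.
- exact: bounded_set_finite_measure.
- exact: open_continuous_measurable_rV.
exists C; split; first exact: num_real.
by move=> M CM x Ox /=; apply: le_trans (fC x Ox) (ltW CM).
Qed.

(** If the function were positive somewhere, it would exceed a positive
    constant on a whole ball, and balls have positive measure. *)
Lemma continuous_Rintegral_eq0 (R : realType) n (Omega : set 'rV[R]_n)
    (f : 'rV[R]_n -> R) :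
  open Omega -> (lebesgue_rV R n).-integrable Omega (EFin \o f) ->
  (forall x, Omega x -> {for x, continuous f}) ->
  (forall x, Omega x -> 0 <= f x) ->
  \int[lebesgue_rV R n]_(x in Omega) f x = 0 ->
  forall x, Omega x -> f x = 0.
Proof.
move=> oO intf cf f0 If x Ox; apply/eqP; rewrite eq_le f0// andbT leNgt.
apply/negP => fx0; pose m := f x / 2.
have m0 : 0 < m by rewrite divr_gt0.
have mfx : m < f x by rewrite /m gtr_pMr ?invf_lt1// ltr1n.
have : \forall y \near x, Omega y /\ m < f y.
  near=> y; split; first by near: y; exact: open_nbhs_nbhs.
  by near: y; exact: cvgr_gt (cf x Ox) _ mfx.
move=> /nbhs_ballP[e /= e0 sB].
have BO : ball x e `<=` Omega by move=> y /sB[].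
have mO := open_measurable_rV oO.
have mB := measurable_ball_rV x e0.
have : (\int[lebesgue_rV R n]_(y in ball x e) m%:E <=
        \int[lebesgue_rV R n]_(y in Omega) (f y)%:E)%E.
  apply: le_trans (ge0_subset_integral _ mB mO _ _ BO); last 2 first.
  - exact: measurable_int intf.
  - by move=> y Oy; rewrite lee_fin f0.
  apply: ge0_le_integral => //.
  - by move=> y _; rewrite lee_fin ltW.
  - apply: (@measurable_funS _ _ _ _ Omega) => //.
    exact: measurable_int intf.
  - by move=> y /sB[_ h]; rewrite lee_fin ltW.
have -> : (\int[lebesgue_rV R n]_(y in Omega) (f y)%:E = 0)%E.
  by rewrite -[LHS]fineK; [congr EFin|exact: integrable_fin_num].
rewrite integral_cst//= lebesgue_rV_ball// -EFinM lee_fin leNgt.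
by rewrite mulr_gt0// exprn_gt0// pmulrn_lgt0.
Unshelve. all: by end_near. Qed.

(** * The charge density *)

Lemma Rintegral_expR_gt0 (R : realType) n (Omega : set 'rV[R]_n)
    (f : 'rV[R]_n -> R) :
  open Omega -> bounded_set Omega -> Omega !=set0 ->
  twice_derivable Omega f ->
  (lebesgue_rV R n).-integrable Omega (EFin \o (expR \o f)) /\
  0 < \int[lebesgue_rV R n]_(x in Omega) expR (f x).
Proof.
move=> oO bO [z Oz] cl; have [C fC] := twice_derivable_bounded bO cl.
have ce x : Omega x -> {for x, continuous (expR \o f)}.
  move=> Ox; apply: continuous_comp; last exact: continuous_expR.
  exact: twice_derivable_continuous cl Ox.
have ie : (lebesgue_rV R n).-integrable Omega (EFin \o (expR \o f)).
  apply: (bounded_continuous_integrable (C := expR C)) => // x Ox /=.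
  rewrite ger0_norm ?expR_ge0// ler_expR (le_trans (ler_norm _))// fC//.
  exact: subset_closure.
split=> //; rewrite lt0r Rintegral_ge0 ?andbT; last by move=> *; exact: expR_ge0.
apply/eqP => I0; suff /= fz0 : (expR \o f) z = 0.
  by have := expR_gt0 (f z); rewrite fz0 ltxx.
by apply: (continuous_Rintegral_eq0 oO ie ce _ I0) => // x _; exact: expR_ge0.
Qed.

Lemma charge_densityN (R : realType) d (I0 : R) (Omega : set 'rV[R]_d)
    (Phi : 'rV[R]_d -> R) (x : 'rV[R]_d) :
  charge_density I0 Omega (fun y => - Phi y) x = - charge_density I0 Omega Phi x.
Proof.
rewrite /charge_density opprK.
under [X in I0 * (expR (Phi x) / X - _)]eq_Rintegral do rewrite opprK.
by rewrite -[RHS]mulrN opprB.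
Qed.

(** Neutrality: each of the two normalised exponentials integrates to one, so
    the density has integral zero, and a continuous function of constant sign
    with integral zero vanishes. *)
Lemma charge_density_ge0_eq0 (R : realType) d (I0 : R) (Omega : set 'rV[R]_d)
    (Phi : 'rV[R]_d -> R) :
  open Omega -> bounded_set Omega -> twice_derivable Omega Phi ->
  (forall x, Omega x -> 0 <= charge_density I0 Omega Phi x) ->
  forall x, Omega x -> charge_density I0 Omega Phi x = 0.
Proof.
move=> oO bO cl rho0 z Oz; have O0 : Omega !=set0 by exists z.
have clN := twice_derivableN oO cl.
have mO := open_measurable_rV oO.
have [iP IP] := Rintegral_expR_gt0 oO bO O0 cl.
have [iN IN] := Rintegral_expR_gt0 oO bO O0 clN.
set A := (X in 0 < X) in IN; set B := (X in 0 < X) in IP.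
have iA : (lebesgue_rV R d).-integrable Omega
    (EFin \o (fun y => expR (- Phi y) / A)).
  have := integrableZr mO A^-1 iN.
  by apply: eq_integrable => // x _ /=; rewrite EFinM.
have iB : (lebesgue_rV R d).-integrable Omega
    (EFin \o (fun y => expR (Phi y) / B)).
  have := integrableZr mO B^-1 iP.
  by apply: eq_integrable => // x _ /=; rewrite EFinM.
have iAB : (lebesgue_rV R d).-integrable Omega
    (EFin \o (fun y => expR (- Phi y) / A - expR (Phi y) / B)).
  have := integrableB mO iA iB.
  by apply: eq_integrable => // x _ /=; rewrite EFinB.
apply: (continuous_Rintegral_eq0 oO) => //.
- have := integrableZl mO I0 iAB.
  by apply: eq_integrable => // x _ /=; rewrite EFinM.
- move=> x Ox; rewrite /charge_density -/A -/B.
  have cexp (f : 'rV[R]_d -> R) : {for x, continuous f} ->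
      {for x, continuous (expR \o f)}.
    move=> cf; apply: (@continuous_comp _ _ _ f expR x cf).
    exact: continuous_expR.
  have cN := cexp _ (twice_derivable_continuous oO clN Ox).
  have cP := cexp _ (twice_derivable_continuous oO cl Ox).
  exact: cvgM (cvg_cst _) (cvgB (cvgM cN (cvg_cst _)) (cvgM cP (cvg_cst _))).
rewrite /charge_density -/A -/B RintegralZl// RintegralB// !RintegralZr//.
by rewrite -/A -/B !divff ?gt_eqF// subrr mulr0.
Qed.

Lemma mono_expR_diff (R : realType) (a b : R) : 0 < a -> 0 < b ->
  {mono (fun s => b * expR s - a * expR (- s)) : s t / s <= t}.
Proof.
move=> a0 b0; apply: le_mono => s t st.
apply: ltrB; first by rewrite ltr_pM2l// ltr_expR.
by rewrite ltr_pM2l// ltr_expR ltrN2.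
Qed.

(** Forgetting that the weights depend on [Phi] turns the nonlocal equation into
    a local one with a monotone nonlinearity. *)
Lemma charge_density_expR_diff (R : realType) d (Omega : set 'rV[R]_d) (I0 : R)
    (Phi : 'rV[R]_d -> R) :
  open Omega -> bounded_set Omega -> Omega !=set0 -> 0 < I0 ->
  twice_derivable Omega Phi ->
  exists a b, [/\ 0 < a, 0 < b & forall x,
    charge_density I0 Omega Phi x = a * expR (- Phi x) - b * expR (Phi x)].
Proof.
move=> oO bO O0 I00 cl; have clN := twice_derivableN oO cl.
have [_ B0] := Rintegral_expR_gt0 oO bO O0 cl.
have [_ A0] := Rintegral_expR_gt0 oO bO O0 clN.
exists (I0 / \int[lebesgue_rV R d]_(x in Omega) expR (- Phi x)).
exists (I0 / \int[lebesgue_rV R d]_(x in Omega) expR (Phi x)).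
split; [exact: divr_gt0|exact: divr_gt0|].
by move=> x; rewrite /charge_density; ring.
Qed.

(** The equation is odd under [Phi -> - Phi], which exchanges the two weights;
    applying the one-sided bounds to both signs makes them two-sided. *)
Lemma charge_density_estimate (R : realType) d (Omega : set 'rV[R]_d)
    (W Phi : 'rV[R]_d -> R) (eps I0 M r : R) (c : 'rV[R]_d) :
  (0 < d)%N -> open Omega -> bounded_set Omega -> 0 < I0 -> 0 < eps ->
  PB_solution eps I0 Omega W Phi ->
  0 <= M -> (forall x, boundary Omega x -> `|W x| <= M) ->
  0 < r -> ball c r `<=` Omega ->
  `|charge_density I0 Omega Phi c| <= eps * ((4 * M / r ^+ 2) *+ d).
Proof.
move=> d0 oO bO I00 eps0 [sP pde bc] M0 WM r0 cr.
have O0 : Omega !=set0 by exists c; apply: cr; exact: ballxx.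
have cl := smooth_on_twice_derivable oO sP.
have clN := twice_derivableN oO cl.
have [a [b [a0 b0 rhoE]]] := charge_density_expR_diff oO bO O0 I00 cl.
pose g s := b * expR s - a * expR (- s).
pose g' s := a * expR s - b * expR (- s).
have gm : {mono g : s t / s <= t} by exact: mono_expR_diff.
have g'm : {mono g' : s t / s <= t} by exact: mono_expR_diff.
have g'N s : g' (- s) = - g s by rewrite /g' /g opprK opprB.
have rhog x : charge_density I0 Omega Phi x = - g (Phi x).
  by rewrite rhoE /g opprB.
have pdeg x : Omega x -> eps * laplacian Phi x = g (Phi x).
  by move=> Ox; apply: oppr_inj; rewrite -rhog -mulNr pde.
have pdeg' x : Omega x ->
    eps * laplacian (fun y => - Phi y) x = g' (- Phi x).
  by move=> Ox; rewrite (laplacianN oO cl Ox) mulrN pdeg.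
have [gM PM] : 0 <= g M /\ forall x, closure Omega x -> Phi x <= M.
  apply: (monotone_max_le (eps := eps)) => //.
    move=> le0 x Ox; apply: oppr_inj; rewrite -rhog oppr0.
    apply: (charge_density_ge0_eq0 oO bO cl _ Ox) => y Oy.
    by rewrite rhog oppr_ge0; exact: le0.
  by move=> x bx; rewrite bc// (le_trans (ler_norm _))// WM.
have [g'M NPM] : 0 <= g' M /\ forall x, closure Omega x -> - Phi x <= M.
  apply: (monotone_max_le (eps := eps)) => //.
    move=> le0 x Ox; rewrite g'N -rhog; apply: oppr_inj.
    rewrite -charge_densityN oppr0.
    apply: (charge_density_ge0_eq0 oO bO clN _ Ox) => y Oy.
    by rewrite charge_densityN rhog opprK -oppr_le0 -g'N; exact: le0.
  by move=> x bx; rewrite bc// (le_trans (ler_norm _))// normrN WM.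
have absP x : closure Omega x -> `|Phi x| <= M.
  by move=> clx; rewrite ler_norml PM// andbT lerNl NPM.
have absNP x : closure Omega x -> `|- Phi x| <= M.
  by rewrite normrN; exact: absP.
rewrite rhog normrN ler_norml lerNl; apply/andP; split.
  rewrite -g'N; apply: (interior_estimate (f := fun y => - Phi y) oO bO) => //.
  by rewrite g'N oppr_le0.
apply: (interior_estimate oO bO) => //.
by rewrite -oppr_ge0 -g'N opprK.
Qed.

(** * Vanishing of the charge density in the interior *)

Theorem theorem2 (R : realType) (d : nat) (hd : d = 2%N \/ d = 3%N)
    (Omega : set 'rV[R]_d)
    (Omega_open : open Omega) (Omega_connected : connected Omega)
    (Omega_bounded : bounded_set Omega) (Omega_smooth : smooth_boundary Omega)
    (W : 'rV[R]_d -> R) (W_smooth : smooth_on (boundary Omega) W)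
    (I0 : R) (I0_gt0 : 0 < I0)
    (Phi : R -> 'rV[R]_d -> R)
    (Phi_solution : forall eps : R, 0 < eps ->
      PB_solution eps I0 Omega W (Phi eps))
    (K : set 'rV[R]_d) (K_compact : compact K) (K_sub : K `<=` Omega) :
  sup [set `|charge_density I0 Omega (Phi eps) x| | x in K] @[eps --> 0^'+]
    --> (0 : R).
Proof.
have d0 : (0 < d)%N by case: hd => ->.
have [->|/set0P[x0 Kx0]] := eqVneq K set0.
  by under eq_fun do rewrite image_set0 sup0; exact: cvg_cst.
(* The solution for one value of the parameter already bounds the data. *)
have [M0 WM0] : exists M, forall x, boundary Omega x -> `|W x| <= M.
  have [sPhi _ bc] := Phi_solution 1 ltr01.
  have [M HM] := twice_derivable_bounded Omega_bounded
    (smooth_on_twice_derivable Omega_open sPhi).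
  by exists M => x bx; rewrite -bc//; apply: HM; case: bx.
have [r [r0 rK]] := uniform_ball_radius K_compact Omega_open K_sub.
pose C := (4 * `|M0| / r ^+ 2) *+ d.
have est eps x : 0 < eps -> K x ->
    `|charge_density I0 Omega (Phi eps) x| <= eps * C.
  move=> eps0 Kx; apply: charge_density_estimate (Phi_solution _ eps0) _ _ _ _ => //.
    by move=> y /WM0 Wy; apply: (le_trans Wy); exact: ler_norm.
  exact: rK.
apply: (@squeeze_cvgr _ _ _ _ (fun=> 0) (fun eps => eps * C)).
- near=> eps.
  have eps0 : 0 < eps by near: eps; exact: nbhs_right_gt.
  pose A := [set `|charge_density I0 Omega (Phi eps) x| | x in K].
  have Aub : ubound A (eps * C) by move=> _ [x Kx <-]; exact: est.
  have A0 : A !=set0 by exists `|charge_density I0 Omega (Phi eps) x0|, x0.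
  apply/andP; split; last exact: ge_sup.
  apply: le_trans (normr_ge0 (charge_density I0 Omega (Phi eps) x0)) _.
  by apply: ub_le_sup; [exists (eps * C)|exists x0].
- exact: cvg_cst.
- rewrite -[X in _ --> X](mul0r C); apply: cvgM; last exact: cvg_cst.
  by apply: cvg_within_filter; exact: cvg_id.
Unshelve. all: by end_near. Qed.
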